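(* Let $Q$ be a polygonal region, and consider the function $\hat{\varepsilon}:\mathbb{R}^+\to\mathbb{R}^+$, $\hat{\varepsilon}(r):=\inf\{\varepsilon\mid\textsc{Decide}(Q,r,\varepsilon)\text{ returns YES}\}$. Then $\hat{\varepsilon}$ is a monotone increasing function. Moreover, $\hat{\varepsilon}$ is Lipschitz-continuous with Lipschitz factor $1$.
   Context: A polygonal region is a (closed) set whose boundary consists of finitely many line segments with disjoint interiors; the input $Q$ is nonempty and bounded. ''Monotone increasing'' is meant in the weak sense: $a<b$ implies $\hat\varepsilon(a)\le\hat\varepsilon(b)$. $D_s(c)$ is the closed disk of radius $s$ around $c$, $D_s:=D_s(0)$, $X^C:=\mathbb{R}^2\setminus X$, $\mathrm{offset}(X,s):=X\oplus D_s$ (Minkowski sum), $\mathrm{inset}(X,s):=\mathrm{offset}(X^C,s)^C=\{x\mid D_s(x)\subseteq X\}$. $\textsc{Decide}(Q,r,\varepsilon)$ (for $r,\varepsilon>0$): $Q_\varepsilon:=\mathrm{offset}(Q,\varepsilon)$, $\Pi:=\mathrm{inset}(Q_\varepsilon,r)$, $Q':=\mathrm{offset}(\Pi,r+\varepsilon)$; return YES if $Q\subseteq Q'$, else NO. (For $\varepsilon\ge r$ it returns YES.) *)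

(* Defs.v *)
From HB Require Import structures.
From mathcomp Require Import all_boot all_order all_algebra.
From mathcomp Require Import all_classical all_reals all_analysis.

Set Implicit Arguments.
Unset Strict Implicit.
Unset Printing Implicit Defensive.

Import Order.TTheory GRing.Theory Num.Theory.
Import numFieldNormedType.Exports.
Local Open Scope classical_set_scope.
Local Open Scope ring_scope.

Section Defs.
Variable R : realType.

(* Euclidean distance: the library norm on R * R is the sup norm, which induces
   the same topology and bounded sets but not the same disks. *)
Definition dist2 (p q : R * R) : R :=
  Num.sqrt ((p.1 - q.1) ^+ 2 + (p.2 - q.2) ^+ 2).

Definition disk (s : R) (c : R * R) : set (R * R) := [set p | dist2 p c <= s].

Definition offset (X : set (R * R)) (s : R) : set (R * R) :=
  [set x + y | x in X & y in disk s 0].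

Definition inset (X : set (R * R)) (s : R) : set (R * R) :=
  ~` offset (~` X) s.

Definition frontier (X : set (R * R)) : set (R * R) :=
  closure X `\` interior X.

Definition segment (a b : R * R) : set (R * R) :=
  [set (1 - t) *: a + t *: b | t in `[0, 1]].

(* The interior of a segment means its relative interior. Degenerate segments,
   with a = b, are allowed. *)
Definition open_segment (a b : R * R) : set (R * R) :=
  [set (1 - t) *: a + t *: b | t in `]0, 1[].

Definition polygonal_region (Q : set (R * R)) : Prop :=
  closed Q /\
  exists (n : nat) (a b : 'I_n -> R * R),
    frontier Q = \bigcup_i segment (a i) (b i) /\
    trivIset setT (fun i => open_segment (a i) (b i)).

(* [Decide Q r e] holds when the procedure returns YES. *)
Definition Decide (Q : set (R * R)) (r e : R) : Prop :=
  let Qe := offset Q e in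
  let Pi := inset Qe r in
  let Q' := offset Pi (r + e) in
  Q `<=` Q'.

(* The library infimum is total, with value 0 when the set is empty. *)
Definition eps_hat (Q : set (R * R)) (r : R) : R :=
  inf [set e | 0 < e /\ Decide Q r e].

End Defs.

(* Main.v *)
(** Enlarging [r] by [delta] costs at most [delta] in [eps]: a disk of radius
    [a] inside the [eps]-offset of [Q] grows to a concentric disk of radius
    [a + delta] inside the [(eps + delta)]-offset. Conversely a disk of radius
    [b] serving a point [q] contains a disk of radius [a < b], with centre moved
    towards [q], that still serves [q]. This gives the Lipschitz bound and
    monotonicity.

    For positivity, a linear functional on [Q] is maximised at an endpoint of one
    of the boundary segments. There are finitely many endpoints, so one endpoint
    [e] maximises two distinct unit directions [u] and [v]. If [e] is within
    [r + eps] of the centre [c] of a disk of radius [r] in the [eps]-offset of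
    [Q], then [e - c] has inner product at least [r - eps] with both [u] and [v],
    hence [2 (r - eps) <= |u + v| (r + eps)]. As [|u + v| < 2], this bounds [eps]
    away from [0]. *)

Require Import Defs.
From HB Require Import structures.
From mathcomp Require Import all_boot all_order all_algebra.
From mathcomp Require Import all_classical all_reals all_analysis.
From mathcomp Require Import ring lra.
Import Order.TTheory GRing.Theory Num.Theory.
Import numFieldNormedType.Exports.
Local Open Scope classical_set_scope.
Local Open Scope ring_scope.

(** * Inner product and Euclidean norm in the plane *)

Definition dot {R : realType} (u v : R * R) : R := u.1 * v.1 + u.2 * v.2.

Definition norm2 {R : realType} (u : R * R) : R := Num.sqrt (dot u u).

Section Euclidean.
Context {R : realType}.
Implicit Types (p q u v : R * R) (s t : R).

Lemma dotDr u p q : dot u (p + q) = dot u p + dot u q.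
Proof. by rewrite /dot /=; ring. Qed.

Lemma dotDl u v p : dot (u + v) p = dot u p + dot v p.
Proof. by rewrite /dot /=; ring. Qed.

Lemma dotBr u p q : dot u (p - q) = dot u p - dot u q.
Proof. by rewrite /dot /=; ring. Qed.

Lemma dotZr u t p : dot u (t *: p) = t * dot u p.
Proof. by rewrite /dot /= /GRing.scale /=; ring. Qed.

Lemma dot_ge0 u : 0 <= dot u u.
Proof. by rewrite /dot -!expr2 addr_ge0 ?sqr_ge0. Qed.

Lemma continuous_dot u : continuous (dot u).
Proof.
by move=> p; apply: cvgD; apply: cvgM;
  (exact: cvg_cst || exact: cvg_fst || exact: cvg_snd).
Qed.

Lemma norm2_ge0 u : 0 <= norm2 u.
Proof. exact: sqrtr_ge0. Qed.

Lemma sqr_norm2 u : norm2 u ^+ 2 = dot u u.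
Proof. by rewrite sqr_sqrtr ?dot_ge0. Qed.

Lemma dist2E p q : dist2 p q = norm2 (p - q).
Proof. by []. Qed.

Lemma dot_le_norm2 u v : dot u v <= norm2 u * norm2 v.
Proof.
rewrite (le_trans (ler_norm _)) // -sqrtr_sqr /norm2 -sqrtrM ?dot_ge0 //.
apply: ler_wsqrtr; rewrite -subr_ge0.
(* Lagrange's identity: the defect in Cauchy-Schwarz is a squared determinant. *)
have -> : dot u u * dot v v - dot u v ^+ 2 = (u.1 * v.2 - u.2 * v.1) ^+ 2.
  by rewrite /dot; ring.
exact: sqr_ge0.
Qed.

Lemma norm2D u v : norm2 (u + v) <= norm2 u + norm2 v.
Proof.
rewrite -(@ler_pXn2r _ 2) ?nnegrE ?addr_ge0 ?norm2_ge0 //.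
rewrite sqrrD !sqr_norm2.
have -> : dot (u + v) (u + v) = dot u u + dot u v *+ 2 + dot v v.
  by rewrite /dot /=; ring.
by rewrite lerD2r lerD2l lerMn2r dot_le_norm2 orbT.
Qed.

Lemma norm2Z t u : norm2 (t *: u) = `|t| * norm2 u.
Proof.
rewrite -sqrtr_sqr /norm2 -sqrtrM ?sqr_ge0 //; congr Num.sqrt.
by rewrite /dot /= /GRing.scale /=; ring.
Qed.

Lemma dist2C p q : dist2 p q = dist2 q p.
Proof. by rewrite /dist2 -sqrrN opprB -[X in _ + X]sqrrN opprB. Qed.

Lemma dist2_triangle p q u : dist2 p u <= dist2 p q + dist2 q u.
Proof. by rewrite !dist2E -(subrKA q) norm2D. Qed.

Lemma dist2_conv p q t : dist2 ((1 - t) *: p + t *: q) p = `|t| * dist2 p q.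
Proof.
rewrite [dist2 p q]dist2C !dist2E -norm2Z; congr norm2.
by rewrite scalerBl scale1r scalerBr addrAC [_ - _ - p]addrAC subrr add0r addrC.
Qed.

(** Lets [dist2_conv] measure the distance to either end of the segment. *)
Lemma conv_flip p q t : (1 - t) *: p + t *: q = (1 - (1 - t)) *: q + (1 - t) *: p.
Proof. by rewrite subKr addrC. Qed.

Lemma unit_norm2D_lt2 u v : dot u u = 1 -> dot v v = 1 -> u <> v ->
  norm2 (u + v) < 2.
Proof.
move=> u1 v1 uv; rewrite -(@ltr_pXn2r _ 2) ?nnegrE ?norm2_ge0 //.
(* The parallelogram law for unit vectors. *)
have E : dot (u + v) (u + v) = 4 - dot (u - v) (u - v).
  transitivity (2 * dot u u + 2 * dot v v - dot (u - v) (u - v)).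
    by rewrite /dot /=; ring.
  by rewrite u1 v1; ring.
have : 0 < dot (u - v) (u - v).
  rewrite lt_neqAle dot_ge0 andbT eq_sym /dot -!expr2 paddr_eq0 ?sqr_ge0 //.
  rewrite !sqrf_eq0 /= !subr_eq0; apply/negP => /andP[/eqP e1 /eqP e2].
  by apply: uv; rewrite [u]surjective_pairing e1 e2 -surjective_pairing.
by rewrite sqr_norm2 E; lra.
Qed.

End Euclidean.

(** * The decision procedure in terms of disks, and its dependence on the radius *)

Section Decide.
Context {R : realType}.
Implicit Types (X Q : set (R * R)) (p q c e u v : R * R) (r s t eps : R).

Lemma offsetP X s p : offset X s p <-> exists2 x, X x & dist2 p x <= s.
Proof.
split=> [[x Xx [y ys <-]]|[x Xx xp]].
  exists x => //; move: ys; rewrite /disk /= !dist2E subr0.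
  by rewrite [x + y]addrC addrK.
exists x => //; exists (p - x); last by rewrite addrC subrK.
by rewrite /disk /= dist2E subr0 -dist2E.
Qed.

Lemma insetP X s p : inset X s p <-> (forall q, dist2 q p <= s -> X q).
Proof.
split=> [ip q qp|h].
  apply: contrapT => Xq; apply: ip; apply/offsetP; exists q => //.
  by rewrite dist2C.
by move/offsetP => [x Xx px]; apply: Xx; apply: h; rewrite dist2C.
Qed.

Lemma DecideP Q r eps : Decide Q r eps <->
  forall q, Q q -> exists2 c, dist2 q c <= r + eps &
    forall p, dist2 p c <= r -> offset Q eps p.
Proof.
rewrite /Decide /=; split=> h q Qq.
  by have /offsetP[c /insetP ? ?] := h q Qq; exists c.
by have [c ? ?] := h q Qq; apply/offsetP; exists c => //; apply/insetP.
Qed.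

Lemma Decide_self Q r : 0 <= r -> Decide Q r r.
Proof.
move=> r0; apply/DecideP => q Qq; exists q.
  rewrite dist2E subrr /norm2 /dot /= !mul0r addr0 sqrtr0; lra.
by move=> p pq; apply/offsetP; exists q.
Qed.

Lemma Decide_shrink Q a b eps : 0 < a -> a <= b -> 0 < eps ->
  Decide Q b eps -> Decide Q a eps.
Proof.
move=> a0 ab e0 /DecideP h; apply/DecideP => q /h[c qc hc].
have be0 : 0 < b + eps by lra.
(* Moving [c] towards [q] by the fraction [t] displaces it by at most [b - a], so the smaller disk
   stays inside the old one, and leaves a distance of at most [(1 - t) * (b + eps) = a + eps] to
   [q]. *)
pose t := (b - a) / (b + eps).
have t0 : 0 <= t by rewrite /t divr_ge0 //; lra.
have tbe : t * (b + eps) = b - a by rewrite /t divfK ?gt_eqF.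
have t1 : 0 <= 1 - t by rewrite subr_ge0 /t ler_pdivrMr //; lra.
exists ((1 - t) *: c + t *: q).
  rewrite dist2C conv_flip dist2_conv ger0_norm //.
  by rewrite (le_trans (ler_wpM2l t1 qc)) // mulrBl mul1r tbe; lra.
move=> p pa; apply: hc; apply: (le_trans (dist2_triangle _ _ _)).
apply: (le_trans (lerD pa (lexx _))).
rewrite dist2_conv ger0_norm // dist2C.
by have := ler_wpM2l t0 qc; rewrite tbe; lra.
Qed.

Lemma Decide_grow Q a eps d : 0 < a -> 0 <= d ->
  Decide Q a eps -> Decide Q (a + d) (eps + d).
Proof.
move=> a0 d0 /DecideP h; apply/DecideP => q /h[c qc hc].
exists c => [|p pc]; first by rewrite (le_trans qc) //; lra.
have ad0 : 0 < a + d by lra.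
(* Contracting towards [c] by the fraction [t] maps the disk of radius [a + d] into that of radius
   [a] and moves each point by at most [d]. *)
pose t := d / (a + d).
have t0 : 0 <= t by rewrite divr_ge0 //; lra.
have tad : t * (a + d) = d by rewrite /t divfK ?gt_eqF.
have t1 : 0 <= 1 - t by rewrite subr_ge0 /t ler_pdivrMr //; lra.
have /hc/offsetP[x Qx px] : dist2 ((1 - t) *: p + t *: c) c <= a.
  rewrite conv_flip dist2_conv ger0_norm // dist2C.
  by rewrite (le_trans (ler_wpM2l t1 pc)) // mulrBl mul1r tad; lra.
apply/offsetP; exists x => //.
apply: (le_trans (dist2_triangle _ ((1 - t) *: p + t *: c) _)).
rewrite [leRHS]addrC lerD // dist2C dist2_conv ger0_norm //.
by rewrite -[leRHS]tad ler_wpM2l.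
Qed.

(** * Extremal points in a direction, and positivity *)

Lemma Decide_dot Q r eps e u : dot u u = 1 -> 0 <= r ->
  (forall q, Q q -> dot u q <= dot u e) ->
  forall c, (forall p, dist2 p c <= r -> offset Q eps p) ->
  r - eps <= dot u (e - c).
Proof.
(* [c + r *: u] is the point of the disk farthest in direction [u]; some point of [Q] lies within
   [eps] of it. *)
move=> u1 r0 ue c cQ; have /cQ/offsetP[x Qx px] : dist2 (c + r *: u) c <= r.
  by rewrite dist2E [c + _]addrC addrK norm2Z /norm2 u1 sqrtr1 mulr1 ger0_norm.
have : dot u (c + r *: u - x) <= eps.
  by rewrite (le_trans (dot_le_norm2 _ _)) // /norm2 u1 sqrtr1 mul1r.
have := ue x Qx.
by rewrite !dotBr dotDr dotZr u1 mulr1; lra.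
Qed.

Lemma bounded_closed_compact2 Q : closed Q -> bounded_set Q -> compact Q.
Proof.
move=> Qc [M [_ /(_ (M + 1))]]; rewrite ltrDl ltr01 => /(_ isT) QM.
(* Balls of the sup norm are squares, hence products of compact intervals. *)
pose S := `[- (M + 1), M + 1]%classic : set R.
apply: (@subclosed_compact _ Q (S `*` S)) => //.
  by apply: compact_setX; exact: segment_compact.
move=> p /QM; rewrite /= prod_normE ge_max !ler_norml => /andP[p1 p2].
by split; rewrite /S /= in_itv.
Qed.

(** A short step from [p] along [u] stays in [Q] and increases [dot u]. *)
Lemma interior_not_max Q u p : dot u u = 1 -> interior Q p ->
  ~ (forall q, Q q -> dot u q <= dot u p).
Proof.
move=> u1 Qp max.
have cf : {for (0 : R), continuous (fun t : R => p + t *: u)}.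
  apply: continuousD; first exact: cst_continuous.
  exact: scalel_continuous.
have : \forall t \near (0 : R), Q (p + t *: u).
  by apply: cf; rewrite scale0r addr0.
move=> /nbhs_ballP[t /= t0 tQ].
have /tQ/max : ball (0 : R) t (t / 2).
  by rewrite -ball_normE /= sub0r normrN gtr0_norm; lra.
by rewrite dotDr dotZr u1 mulr1; lra.
Qed.

Lemma segment_max u a b p : segment a b p ->
  dot u p <= dot u a \/ dot u p <= dot u b.
Proof.
move=> [t /=]; rewrite in_itv /= => /andP[t0 t1] <-.
rewrite dotDr !dotZr.
by have [|] := leP (dot u a) (dot u b); [right|left]; nra.
Qed.

Lemma segment_left (a b : R * R) : segment a b a.
Proof.
by exists 0; rewrite ?subr0 ?scale1r ?scale0r ?addr0 //= in_itv /= lexx ler01.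
Qed.

Lemma segment_right (a b : R * R) : segment a b b.
Proof.
by exists 1; rewrite ?subrr ?scale1r ?scale0r ?add0r //= in_itv /= lexx ler01.
Qed.

(** A maximiser exists by compactness and lies on the frontier, so some end of its segment does as
    well. Labelling endpoints by the finite type ['I_n * bool] prepares a pigeonhole argument. *)
Lemma dot_max_endpoint Q n (a b : 'I_n -> R * R) u :
  closed Q -> bounded_set Q -> Q !=set0 ->
  frontier Q = \bigcup_i segment (a i) (b i) -> dot u u = 1 ->
  exists x : 'I_n * bool, let e := if x.2 then a x.1 else b x.1 in
    Q e /\ forall q, Q q -> dot u q <= dot u e.
Proof.
move=> Qc Qb Qn fQ u1.
have [p /set_mem Qp pmax] := compact_EVT_max Qn (bounded_closed_compact2 Q Qc Qb)
  (continuous_subspaceT (continuous_dot u)).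
have {}pmax q : Q q -> dot u q <= dot u p by move=> /mem_set/pmax.
have : frontier Q p.
  by split; [exact: subset_closure|move=> /(interior_not_max Q u p u1)].
have subQ i q : segment (a i) (b i) q -> Q q.
  move=> iq; have [] : frontier Q q by rewrite fQ; exists i.
  by move=> /Qc.
rewrite fQ => -[i _ /(segment_max u)[ua|ub]].
- exists (i, true); split=> [|q /pmax qp] /=; last exact: le_trans ua.
  exact/subQ/segment_left.
- exists (i, false); split=> [|q /pmax qp] /=; last exact: le_trans ub.
  exact/subQ/segment_right.
Qed.

(* The rational parametrization of the unit circle. *)
Definition circle_pt (k : nat) : R * R :=
  ((1 - k%:R ^+ 2) / (1 + k%:R ^+ 2), (2 * k%:R) / (1 + k%:R ^+ 2)).

Let circle_den (k : nat) : 0 < 1 + k%:R ^+ 2 :> R.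
Proof. by rewrite ltr_pwDl // sqr_ge0. Qed.

Lemma circle_pt_unit k : dot (circle_pt k) (circle_pt k) = 1.
Proof.
by rewrite /dot /circle_pt /=; field; rewrite gt_eqF.
Qed.

(** The first coordinate already determines [k ^ 2], hence [k]. *)
Lemma circle_pt_inj : injective circle_pt.
Proof.
move=> k l [e _].
have : (k%:R ^+ 2 : R) = l%:R ^+ 2.
  by move/eqP: e; rewrite eqr_div ?lt0r_neq0 // => /eqP; lra.
move/eqP; rewrite eqrXn2 ?ler0n // => /eqP /mulrIn; apply.
exact: oner_neq0.
Qed.

Lemma shared_maximizer Q : polygonal_region Q -> Q !=set0 -> bounded_set Q ->
  exists u v e, [/\ dot u u = 1, dot v v = 1, u <> v, Q e &
    forall q, Q q -> dot u q <= dot u e /\ dot v q <= dot v e].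
Proof.
move=> [Qc [n [a [b [fQ _]]]]] Qn Qb.
have /choice[f fP] := fun k : nat => dot_max_endpoint Q n a b (circle_pt k)
  Qc Qb Qn fQ (circle_pt_unit k).
(* Pigeonhole: one more direction than there are endpoint labels. *)
have /injectivePn[k [l kl fkl]] :
    ~~ injectiveb (fun k : 'I_(#|{: 'I_n * bool}|.+1) => f k).
  by apply/negP => /injectiveP/leq_card; rewrite card_ord ltnn.
have [Qe ke] := fP k; have [_ le] := fP l.
exists (circle_pt k), (circle_pt l), (if (f k).2 then a (f k).1 else b (f k).1).
split; rewrite ?circle_pt_unit //.
  by move/circle_pt_inj/val_inj => E; rewrite E eqxx in kl.
by move=> q Qq; split; [exact: ke|rewrite fkl; exact: le].
Qed.

Lemma Decide_eps_lb Q r : polygonal_region Q -> Q !=set0 -> bounded_set Q ->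
  0 < r -> exists2 d : R, 0 < d & forall eps, 0 < eps -> Decide Q r eps -> d <= eps.
Proof.
move=> Qp Qn Qb r0.
have [u [v [e [u1 v1 uv Qe emax]]]] := shared_maximizer Q Qp Qn Qb.
pose s := norm2 (u + v).
have s0 : 0 <= s := norm2_ge0 _.
have s2 : s < 2 := unit_norm2D_lt2 u v u1 v1 uv.
(* The value of [eps] at which [2 * (r - eps) = s * (r + eps)]. *)
exists (r * (2 - s) / (2 + s)); first by rewrite divr_gt0 ?mulr_gt0 //; lra.
move=> eps e0 /DecideP/(_ e Qe)[c ec cP].
rewrite ler_pdivrMr; last lra.
have Du := Decide_dot Q r eps e u u1 (ltW r0) (fun q Qq => proj1 (emax q Qq)) c cP.
have Dv := Decide_dot Q r eps e v v1 (ltW r0) (fun q Qq => proj2 (emax q Qq)) c cP.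
have : dot (u + v) (e - c) <= s * (r + eps).
  by rewrite (le_trans (dot_le_norm2 _ _)) // ler_wpM2l.
by rewrite dotDl; lra.
Qed.

End Decide.

(** * Passing to the infimum *)

Section EpsHat.
Context {R : realType}.
Implicit Types (Q : set (R * R)) (r a b : R).

Lemma eps_hat_le Q r eps : 0 < eps -> Decide Q r eps -> eps_hat Q r <= eps.
Proof.
by move=> e0 De; apply: ge_inf => //; exists 0 => x [/ltW].
Qed.

Lemma le_eps_hat Q r d : 0 < r ->
  (forall eps, 0 < eps -> Decide Q r eps -> d <= eps) -> d <= eps_hat Q r.
Proof.
move=> r0 h; apply: lb_le_inf => [|eps []]; last exact: h.
(* The value [r] is always accepted, so the infimum is over a nonempty set and not the default
   [0]. *)
by exists r; split=> //; apply: Decide_self; exact: ltW.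
Qed.

Lemma eps_hat_homo Q a b : 0 < a -> a <= b -> eps_hat Q a <= eps_hat Q b.
Proof.
move=> a0 ab; apply: le_eps_hat => [|eps e0 De]; first exact: lt_le_trans ab.
by apply: eps_hat_le => //; exact: Decide_shrink De.
Qed.

Lemma eps_hat_growth Q a b : 0 < a -> a <= b ->
  eps_hat Q b <= eps_hat Q a + (b - a).
Proof.
move=> a0 ab; rewrite -lerBlDr; apply: le_eps_hat => // eps e0 De.
rewrite lerBlDr; apply: eps_hat_le; first lra.
have -> : b = a + (b - a) by rewrite addrC subrK.
by rewrite [a + _ - a]addrAC subrr add0r; apply: Decide_grow => //; lra.
Qed.

End EpsHat.

Theorem theorem21 (R : realType) (Q : set (R * R))
    (Qpoly : polygonal_region Q) (Qne : Q !=set0) (Qbd : bounded_set Q) :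
  [/\ forall r : R, 0 < r -> 0 < eps_hat Q r,
      forall a b : R, 0 < a -> 0 < b -> a < b -> eps_hat Q a <= eps_hat Q b
    & 1.-lipschitz_[set r : R | 0 < r] (eps_hat Q)].
Proof.
split=> [r r0|a b a0 _ /ltW|[a b] /= [a0 b0]]; last 1 first.
- wlog ab : a b a0 b0 / a <= b => [hw|].
    have [/hw|/ltW/hw] := leP a b; first exact.
    by rewrite distrC [`|b - a|]distrC; exact.
  rewrite mul1r distrC [`|a - b|]distrC.
  (* Monotonicity removes the absolute values, leaving the one-sided growth bound. *)
  rewrite !ger0_norm ?subr_ge0 //; last exact: eps_hat_homo.
  by rewrite lerBlDl; exact: eps_hat_growth.
- have [d d0 dP] := Decide_eps_lb Q r Qpoly Qne Qbd r0.
  by apply: (lt_le_trans d0); exact: le_eps_hat.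
- exact: eps_hat_homo.
Qed.
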